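(* For any $n\ge 1$ we have $$\lambda(\mathcal{S}^{n,1})=\left\{\lambda\in\mathbb{R}^n : \sum_{j=1}^n\lambda_j\ge 0\right\}.$$
   Context: $\mathcal{S}^{n,1}$ denotes the set of $n\times n$ real symmetric matrices all of whose $1\times 1$ principal submatrices are positive semidefinite, i.e. all of whose diagonal entries are nonnegative. For a real symmetric $n\times n$ matrix $X$, $\lambda_1(X)\ge\dots\ge\lambda_n(X)$ are its eigenvalues in decreasing order, counted with multiplicity, and for a permutation $\sigma\in S_n$ of $\{1,\dots,n\}$ one writes $\lambda(X)^\sigma=(\lambda_{\sigma_1}(X),\dots,\lambda_{\sigma_n}(X))$. Then $\lambda(\mathcal{S}^{n,1})=\{\lambda(X)^\sigma : X\in\mathcal{S}^{n,1},\ \sigma\in S_n\}\subset\mathbb{R}^n$. *)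

(* Defs.v *)
From HB Require Import structures.
From mathcomp Require Import all_boot all_order all_algebra all_fingroup.
From mathcomp Require Import sesquilinear spectral.
From mathcomp Require Import complex.
From mathcomp Require Import boolp classical_sets reals.

Set Implicit Arguments.
Unset Strict Implicit.
Unset Printing Implicit Defensive.

Import Order.TTheory GRing.Theory Num.Theory.

Local Open Scope ring_scope.
Local Open Scope classical_set_scope.

Section Definitions.
Context {R : realType}.

Definition psdmx (m : nat) (A : 'M[R]_m) : Prop :=
  A \is symmetricmx /\ forall x : 'rV[R]_m, 0 <= (x *m A *m x^T) 0 0.

(* The principal submatrix indexed by I keeps the rows and columns in I, in
   increasing order. *)
Definition principal_submx (n : nat) (I : {set 'I_n}) (X : 'M[R]_n) :
    'M[R]_#|I| :=
  mxsub enum_val enum_val X.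

(* S^{n,k} *)
Definition locally_psd (n k : nat) : set 'M[R]_n :=
  [set X | X \is symmetricmx /\
    forall I : {set 'I_n}, #|I| = k -> psdmx (principal_submx I X)].

Definition is_spectrum (n : nat) (X : 'M[R]_n) (l : 'rV[R]_n) : Prop :=
  (forall i j : 'I_n, (i <= j)%N -> l 0 j <= l 0 i) /\
  char_poly X = \prod_(i < n) ('X - (l 0 i)%:P).

(* (lambda_1(X), ..., lambda_n(X)). The default value 0 of xget is only
   reached when the characteristic polynomial does not split over R, hence
   never on symmetric matrices (eigvalsP). *)
Definition eigvals (n : nat) (X : 'M[R]_n) : 'rV[R]_n :=
  xget 0 [set l | is_spectrum X l].

(* lambda(S); col_perm s l has l 0 (s j) as its j-th entry. *)
Definition eigvals_set (n : nat) (S : set 'M[R]_n) : set 'rV[R]_n :=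
  [set l | exists X : 'M[R]_n, exists s : 'S_n,
    S X /\ l = col_perm s (eigvals X)].

End Definitions.

Section Eigvals.
Context {R : realType}.

Lemma is_spectrum_inj (n : nat) (X : 'M[R]_n) (l l' : 'rV[R]_n) :
  is_spectrum X l -> is_spectrum X l' -> l = l'.
Proof.
pose t (v : 'rV[R]_n) := [seq v 0 i | i : 'I_n].
have szt (v : 'rV[R]_n) : size (t v) = n by rewrite size_map size_enum_ord.
have tE (v : 'rV[R]_n) (i : 'I_n) : (t v)`_i = v 0 i.
  by rewrite (nth_map i) ?size_enum_ord ?ltn_ord // nth_ord_enum.
have prodt (v : 'rV[R]_n) : \prod_(i < n) ('X - (v 0 i)%:P) = \prod_(a <- t v) ('X - a%:P).
  by rewrite big_map big_enum.
have srt (v : 'rV[R]_n) : (forall i j : 'I_n, (i <= j)%N -> v 0 j <= v 0 i) ->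
    sorted >=%R (t v).
  move=> dv; apply/(sortedP 0) => i; rewrite szt => i1n.
  have i0n : (i < n)%N by apply: ltnW.
  by have := dv (Ordinal i0n) (Ordinal i1n) (leqnSn i); rewrite -!tE.
move=> [dl El] [dl' El'].
have pe : perm_eq (t l) (t l').
  by apply: prod_XsubC_eq; rewrite -!prodt -El -El'.
have tt' : t l = t l'.
  apply: (sorted_eq (leT := >=%R)) (srt _ dl) (srt _ dl') pe.
    exact: ge_trans.
  exact: ge_anti.
by apply/rowP => i; rewrite -!tE tt'.
Qed.

Lemma is_spectrum_ex (n : nat) (X : 'M[R]_n) :
  X \is symmetricmx -> exists l, is_spectrum X l.
Proof.
move=> /is_hermitianmxP; rewrite expr0 scale1r map_mx_id // => XT.
pose A : 'M[R[i]]_n := map_mx (real_complex R) X.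
have Aherm : A \is hermsymmx.
  apply/is_hermitianmxP; rewrite expr0 scale1r; apply/matrixP => i j.
  by rewrite [in LHS]/A XT !mxE; apply/eqP; rewrite eq_complex /= oppr0 !eqxx.
pose d := spectral_diag A.
have dE i : d 0 i = real_complex R (complex.Re (d 0 i)).
  have /mxOverP/(_ 0 i) := hermitian_spectral_diag_real Aherm.
  by move=> /RRe_real; rewrite -/d => {1}<-.
have cA : char_poly A = \prod_(i < n) ('X - (d 0 i)%:P).
  have /orthomx_spectralP EA := hermitian_normalmx Aherm.
  transitivity (char_poly (diag_mx d)); last first.
    rewrite char_poly_trig ?diag_mx_is_trig //.
    by apply: eq_bigr => i _; rewrite mxE eqxx mulr1n.
  rewrite /char_poly /char_poly_mx EA !map_mxM /= -/d.
  set P := map_mx _ (spectralmx A); set Q := map_mx _ (invmx _).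
  have QP : Q *m P = 1%:M by rewrite -map_mxM mulVmx ?spectral_unit // map_mx1.
  have {1}-> : 'X%:M = Q *m 'X%:M *m P by rewrite scalar_mxC -mulmxA QP mulmx1.
  by rewrite -mulmxBl -mulmxBr !det_mulmx mulrAC -det_mulmx QP det1 mul1r.
have cX : char_poly X = \prod_(i < n) ('X - (complex.Re (d 0 i))%:P).
  apply: (map_poly_inj (real_complex R)).
  rewrite map_char_poly -/A cA rmorph_prod; apply: eq_bigr => i _.
  by rewrite rmorphB /= map_polyX map_polyC /= -dE.
pose t := sort >=%R [seq complex.Re (d 0 i) | i : 'I_n].
have szt : size t = n by rewrite size_sort size_map size_enum_ord.
exists (\row_i t`_i); split => [i j ij|].
  rewrite !mxE; apply: (sorted_leq_nth (leT := >=%R)) => //.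
  - exact: ge_trans.
  - exact: lexx.
  - by rewrite /t; apply: sort_sorted => x y; exact: le_total.
  - by rewrite inE szt.
  - by rewrite inE szt.
transitivity (\prod_(a <- t) ('X - a%:P)).
  rewrite cX (perm_big _ (permEl (perm_sort _ _))) /= big_map big_enum //.
by rewrite (big_nth 0) szt big_mkord; apply: eq_bigr => i _; rewrite mxE.
Qed.

Lemma eigvalsP (n : nat) (X : 'M[R]_n) :
  X \is symmetricmx -> is_spectrum X (eigvals X).
Proof. by move=> /is_spectrum_ex; exact: xgetPex. Qed.

Lemma eigvals_eq (n : nat) (X : 'M[R]_n) (l : 'rV[R]_n) :
  is_spectrum X l -> eigvals X = l.
Proof. by move=> Xl; apply: xget_unique => // l' /is_spectrum_inj; apply. Qed.

End Eigvals.

(* Main.v *)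
Require Import Defs.
From mathcomp Require Import all_boot all_order all_algebra all_fingroup.
From mathcomp Require Import sesquilinear.
From mathcomp Require Import ring lra.
From mathcomp Require Import boolp classical_sets reals.

Set Implicit Arguments.
Unset Strict Implicit.
Unset Printing Implicit Defensive.

Import Order.TTheory GRing.Theory Num.Theory.

Local Open Scope ring_scope.
Local Open Scope classical_set_scope.

(** A matrix lies in S^{n,1} exactly when it is symmetric with nonnegative
    diagonal ([locally_psd1P]). Its trace is then nonnegative, and the trace is
    the sum of the eigenvalues, since it can be read off the characteristic
    polynomial ([tr_char_poly]). This gives one inclusion.

    Conversely, let l have nonnegative sum. The matrix diag(l) has the right
    eigenvalues and nonnegative trace, but its diagonal may have negative
    entries. These are repaired by orthogonal conjugations, which preserve the
    eigenvalues and the trace ([nonneg_diag_ex]). If X has an entry X i i < 0,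
    then since tr X >= 0 it has an entry X j j > 0; so the quadratic form of X
    restricted to the plane spanned by e_i and e_j is indefinite and vanishes
    at some unit vector y ([isotropic_unit_vector]). The reflection exchanging
    e_i and y is orthogonal and fixes every other e_k ([reflection_ex]), so
    conjugating by it makes the i-th diagonal entry 0 and changes no other
    diagonal entry except the j-th ([conj_diag_zero]). The number of nonzero
    diagonal entries drops, because the j-th entry was already nonzero, so the
    process stops, and it can only stop at a nonnegative diagonal. *)

Lemma symmetricmxE (R : fieldType) (n : nat) (X : 'M[R]_n) :
  (X \is symmetricmx) = (X^T == X).
Proof.
by apply/is_hermitianmxP/eqP; rewrite expr0 scale1r map_mx_id.
Qed.

Lemma char_poly_conj_invol (R : comNzRingType) (n : nat) (X H : 'M[R]_n) :
  H *m H = 1%:M -> char_poly (H *m X *m H) = char_poly X.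
Proof.
move=> HH; rewrite /char_poly /char_poly_mx !map_mxM /=.
set P := map_mx _ H; have PP : P *m P = 1%:M by rewrite -map_mxM HH map_mx1.
have {1}-> : 'X%:M = P *m 'X%:M *m P by rewrite scalar_mxC -mulmxA PP mulmx1.
by rewrite -mulmxBl -mulmxBr !det_mulmx mulrAC -det_mulmx PP det1 mul1r.
Qed.

(** Reflection in the hyperplane orthogonal to u = e - y. As e and y are unit
    vectors, u . u = 2 (1 - e . y) and e . u = 1 - e . y, so that the hypothesis
    e . y != 1 makes the coefficient of the reflection well defined, and the
    reflection sends e to e - u = y. *)
Lemma reflection_ex (R : fieldType) (n : nat) (e y : 'rV[R]_n) :
    e *m e^T = 1%:M -> y *m y^T = 1%:M -> (e *m y^T) 0 0 != 1 ->
  exists H : 'M[R]_n, [/\ H^T = H, H *m H = 1%:M, e *m H = y &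
    forall z : 'rV[R]_n, z *m e^T = 0 -> z *m y^T = 0 -> z *m H = z].
Proof.
move=> ee yy ey1; set a := (e *m y^T) 0 0 in ey1.
have a1 : 1 - a != 0 by rewrite subr_eq0 eq_sym.
have eyE : e *m y^T = a%:M by rewrite [LHS]mx11_scalar.
have yeE : y *m e^T = a%:M by rewrite -[LHS]trmxK trmx_mul trmxK eyE tr_scalar_mx.
have [u uE] : exists u, u = e - y by exists (e - y).
pose t := (1 - a)^-1.
have eu : e *m u^T = (1 - a)%:M by rewrite uE linearB mulmxBr ee eyE raddfB.
have uu : u *m u^T = ((1 - a) *+ 2)%:M.
  rewrite {1}uE mulmxBl eu uE linearB mulmxBr yy yeE mulr2n.
  by rewrite !raddfD /= !raddfN /= opprK [- _ + _]addrC.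
exists (1%:M - t *: (u^T *m u)); split.
- by rewrite linearB /= trmx1 linearZ /= trmx_mul trmxK.
- rewrite mulmxBl mul1mx mulmxBr mulmx1 -scalemxAl -scalemxAr.
  rewrite mulmxA -(mulmxA u^T u) uu mul_mx_scalar -scalemxAl !scalerA.
  have -> : t * (t * ((1 - a) *+ 2)) = t *+ 2.
    by rewrite mulrnAr -/t mulVf // mulrnAr mulr1.
  by rewrite mulr2n scalerDl opprB addrK subrK.
- rewrite mulmxBr mulmx1 -scalemxAr mulmxA eu mul_scalar_mx scalerA.
  by rewrite mulVf // scale1r uE opprB addrC subrK.
move=> z ze zy.
have zu : z *m u^T = 0 by rewrite uE linearB mulmxBr ze zy subrr.
rewrite mulmxBr mulmx1 -scalemxAr mulmxA.
by rewrite zu mul0mx scaler0 subr0.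
Qed.

(** The binary form with matrix [[a, h], [h, b]] has negative determinant, so it
    vanishes on some line. That line is not the first axis, because a != 0; this
    is the condition al != 1, which lets [reflection_ex] apply. *)
Lemma isotropic_unit_vector (R : rcfType) (a b h : R) : a < 0 -> 0 < b ->
  exists al be : R, [/\ al ^+ 2 + be ^+ 2 = 1, al != 1 &
    al ^+ 2 * a + (al * be * h) *+ 2 + be ^+ 2 * b = 0].
Proof.
move=> a0 b0; pose D := h ^+ 2 - a * b.
have D0 : 0 <= D by rewrite /D; nra.
(* x is a root of a + 2 h x + b x^2, that is, (1, x) spans an isotropic line;
   dividing by r below normalizes this vector. *)
pose x := (Num.sqrt D - h) / b.
have xE : a + (x * h) *+ 2 + x ^+ 2 * b = 0.
  have := sqr_sqrtr D0; rewrite /x; move: (Num.sqrt D) => s sE.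
  apply: (mulfI (lt0r_neq0 b0)); rewrite mulr0.
  have -> : b * (a + ((s - h) / b * h) *+ 2 + ((s - h) / b) ^+ 2 * b) =
    s ^+ 2 - h ^+ 2 + a * b by field; rewrite lt0r_neq0.
  by rewrite sE /D; ring.
pose r := Num.sqrt (1 + x ^+ 2).
have r2 : r ^+ 2 = 1 + x ^+ 2 by rewrite sqr_sqrtr //; nra.
have r0 : r != 0 by rewrite gt_eqF // sqrtr_gt0; nra.
have x0 : x != 0.
  by apply/eqP => x0; move: xE; rewrite x0; nra.
have n1 : r^-1 ^+ 2 + (x / r) ^+ 2 = 1.
  have -> : r^-1 ^+ 2 + (x / r) ^+ 2 = (1 + x ^+ 2) / r ^+ 2 by field.
  by rewrite r2 divff // -r2 expf_neq0.
exists r^-1, (x / r); split => //.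
  apply/eqP => r1; move/eqP: n1; rewrite r1 expr1n -subr_eq0 addrAC subrr add0r.
  by rewrite mulr1 sqrf_eq0 (negPf x0).
have -> : r^-1 ^+ 2 * a + (r^-1 * (x / r) * h) *+ 2 + (x / r) ^+ 2 * b =
  (a + (x * h) *+ 2 + x ^+ 2 * b) / r ^+ 2 by field.
by rewrite xE mul0r.
Qed.

(** For symmetric H, a diagonal entry of the conjugate is the value of the
    quadratic form of X at the image of a basis vector; this is how the action
    of H on rows, given by [reflection_ex], determines the new diagonal. *)
Lemma conj_sym_diag (R : comNzRingType) (n : nat) (X H : 'M[R]_n) (i : 'I_n) :
  H^T = H ->
  (H *m X *m H) i i =
  ((delta_mx 0 i : 'rV_n) *m H *m X *m ((delta_mx 0 i : 'rV_n) *m H)^T) 0 0.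
Proof.
by move=> HT; rewrite -rowE tr_row HT -row_mul colE mulmxA -row_mul -colE !mxE.
Qed.

Lemma delta_quad (R : comNzRingType) (n : nat) (X : 'M[R]_n) (i j : 'I_n) :
  ((delta_mx 0 i : 'rV_n) *m X *m (delta_mx 0 j : 'rV_n)^T) = (X i j)%:M.
Proof. by rewrite -rowE trmx_delta -colE [LHS]mx11_scalar !mxE. Qed.

Lemma conj_diag_zero (R : rcfType) (n : nat) (X : 'M[R]_n) (i j : 'I_n) :
    X^T = X -> X i i < 0 -> 0 < X j j ->
  exists Y : 'M[R]_n, [/\ Y^T = Y, char_poly Y = char_poly X, Y i i = 0 &
    forall k, k != i -> k != j -> Y k k = X k k].
Proof.
move=> XT Xi Xj.
have ij : i != j by apply: contraTneq Xi => ->; rewrite -leNgt ltW.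
have [al [be [n1 al1 q0]]] := isotropic_unit_vector (X i j) Xi Xj.
pose e k : 'rV[R]_n := delta_mx 0 k.
have ee k l : e k *m (e l)^T = ((k == l)%:R)%:M.
  rewrite trmx_delta mul_delta_mx_cond eq_sym; apply/matrixP => p q.
  by rewrite !ord1 !mxE; case: eqP; rewrite !mxE ?eqxx.
pose y := al *: e i + be *: e j.
have ey k : e k *m y^T = (al * (k == i)%:R + be * (k == j)%:R)%:M.
  by rewrite linearD !linearZ /= mulmxDr -!scalemxAr !ee !scale_scalar_mx -raddfD.
have yy : y *m y^T = 1%:M.
  rewrite {1}/y mulmxDl -!scalemxAl !ey !eqxx (negPf ij) eq_sym (negPf ij).
  rewrite !scale_scalar_mx -raddfD /=; congr _%:M.
  by rewrite -[RHS]n1 /=; ring.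
have [||H [HT HH eH Hz]] := reflection_ex (e := e i) _ yy.
- by rewrite ee eqxx.
- by rewrite ey eqxx (negPf ij) !mxE eqxx mulr1n mulr1 mulr0 addr0.
exists (H *m X *m H); split.
- by rewrite !trmx_mul HT XT mulmxA.
- exact: char_poly_conj_invol.
- rewrite conj_sym_diag // eH {1}/y mulmxDl linearD !linearZ /=.
  rewrite mulmxDl !mulmxDr -!scalemxAl -!scalemxAr.
  have Xji : X j i = X i j by rewrite -{1}XT mxE.
  rewrite !delta_quad Xji !scale_scalar_mx -!raddfD /= mxE eqxx mulr1n.
  by rewrite -[RHS]q0; ring.
move=> k ki kj; rewrite conj_sym_diag // Hz.
- by rewrite delta_quad mxE eqxx mulr1n.
- by rewrite ee (negPf ki) raddf0.
- by rewrite ey (negPf ki) (negPf kj) !mulr0 addr0 raddf0.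
Qed.

Lemma tr_char_poly (R : nzRingType) (n : nat) (X Y : 'M[R]_n) :
  char_poly X = char_poly Y -> \tr X = \tr Y.
Proof.
case: n X Y => [|n] X Y XY; first by rewrite /mxtrace !big_ord0.
by apply: oppr_inj; rewrite -!char_poly_trace // XY.
Qed.

(** Induction on the number of nonzero diagonal entries. The number of negative
    entries would not do as a measure: zeroing X i i turns X j j into
    X i i + X j j, which can be negative. *)
Lemma nonneg_diag_ex (R : rcfType) (n : nat) (X : 'M[R]_n) :
    X^T = X -> 0 <= \tr X ->
  exists Y : 'M[R]_n,
    [/\ Y^T = Y, char_poly Y = char_poly X & forall i, 0 <= Y i i].
Proof.
have [m] := ubnP #|[pred i | X i i != 0]|; elim: m X => // m IHm X.
rewrite ltnS => Xm XT tX.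
have [/forallP X0|] := boolP [forall i, 0 <= X i i]; first by exists X.
rewrite negb_forall => /existsP[i]; rewrite -ltNge => Xi.
have [/existsP[j Xj]|] := boolP [exists j, 0 < X j j]; last first.
  rewrite negb_exists => /forallP Xn.
  have : \tr X < 0; last by rewrite ltNge tX.
  rewrite /mxtrace (bigD1 i) //= ltr_wnDr // sumr_le0 // => k _.
  by rewrite leNgt Xn.
have [Y [YT YX Yi Yk]] := conj_diag_zero XT Xi Xj.
have [|//||Z [ZT ZY Z0]] := IHm Y.
- apply: leq_trans Xm; apply: proper_card; apply/properP; split.
    apply/fintype.subsetP => k; rewrite !inE; apply: contraNneq => Xk.
    rewrite Yk ?Xk //; apply: contra_eq_neq Xk => ->.
      by rewrite lt_eqF.
    by rewrite gt_eqF.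
  by exists i; rewrite !inE ?Yi ?eqxx ?lt_eqF.
- by rewrite (tr_char_poly YX).
by exists Z; rewrite ZY YX.
Qed.

Lemma locally_psd1P (R : realType) (n : nat) (X : 'M[R]_n) :
  locally_psd 1 X <-> X^T = X /\ forall i, 0 <= X i i.
Proof.
split=> [[]|[XT X0]]; rewrite /= ?symmetricmxE.
  move=> /eqP XT psdX; split=> // i.
  (* The 1 x 1 form evaluated at the vector (1) is the entry itself. *)
  have [_ /(_ (const_mx 1))] := psdX [set i]%SET (cards1 i).
  rewrite mxE (eq_bigr (fun=> X i i)) ?sumr_const ?card_ord ?cards1 ?mulr1n //.
  move=> k _; rewrite !mxE mulr1 (eq_bigr (fun=> X i i)).
    by rewrite sumr_const card_ord cards1 mulr1n.
  move=> l _; rewrite !mxE mul1r.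
  by have /set1P-> := enum_valP k; have /set1P-> := enum_valP l.
split=> [|I I1]; first by rewrite symmetricmxE XT.
split.
  rewrite symmetricmxE -{2}XT; apply/eqP/matrixP => k l.
  by rewrite !mxE.
move=> x; rewrite mxE; apply: sumr_ge0 => k _.
rewrite !mxE mulr_suml; apply: sumr_ge0 => l _.
have val0 (p : 'I_#|I|) : val p = 0%N.
  by apply/eqP; rewrite -leqn0 -ltnS -[X in (_ < X)%N]I1 ltn_ord.
have -> : l = k by apply: val_inj; rewrite !val0.
by rewrite !mxE mulrAC -expr2 mulr_ge0 ?sqr_ge0.
Qed.

Lemma char_poly_diag (R : comNzRingType) (n : nat) (l : 'rV[R]_n) :
  char_poly (diag_mx l) = \prod_(i < n) ('X - (l 0 i)%:P).
Proof.
rewrite char_poly_trig ?diag_mx_is_trig //.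
by apply: eq_bigr => i _; rewrite mxE eqxx mulr1n.
Qed.

(** Unique factorization, restated for row vectors in the shape required by
    [eigvals_set]. *)
Lemma prod_XsubC_perm (R : fieldType) (n : nat) (l m : 'rV[R]_n) :
    \prod_(i < n) ('X - (l 0 i)%:P) = \prod_(i < n) ('X - (m 0 i)%:P) ->
  exists s : 'S_n, l = col_perm s m.
Proof.
pose t (v : 'rV[R]_n) := [tuple v 0 i | i < n].
have prodt (v : 'rV[R]_n) : \prod_(i < n) ('X - (v 0 i)%:P) = \prod_(a <- t v) ('X - a%:P).
  by rewrite big_map big_enum.
rewrite !prodt => /prod_XsubC_eq /tuple_permP[s lms]; exists s.
apply/rowP => i; rewrite mxE.
have -> : l 0 i = tnth (t l) i by rewrite tnth_mktuple.
rewrite (_ : t l = [tuple tnth (t m) (s i) | i < n]) ?tnth_mktuple //.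
exact: val_inj.
Qed.

Theorem theorem1p5 (R : realType) (n : nat) (hn : (1 <= n)%N) :
  eigvals_set (@locally_psd R n 1) =
  [set l : 'rV[R]_n | 0 <= \sum_(j < n) l 0 j].
Proof.
apply/seteqP; split=> l /=.
  move=> [X [s [/locally_psd1P[XT X0] ->]]].
  have [_ Xl] : is_spectrum X (eigvals X).
    by apply: eigvalsP; rewrite symmetricmxE XT.
  rewrite -char_poly_diag in Xl.
  have -> : \sum_(j < n) col_perm s (eigvals X) 0 j = \tr X.
    rewrite (tr_char_poly Xl) mxtrace_diag [RHS](reindex_inj (@perm_inj _ s)).
    by apply: eq_bigr => j _; rewrite mxE.
  exact: sumr_ge0.
rewrite -mxtrace_diag => /(nonneg_diag_ex (tr_diag_mx l))[X [XT Xl X0]].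
have [_] : is_spectrum X (eigvals X).
  by apply: eigvalsP; rewrite symmetricmxE XT.
rewrite Xl char_poly_diag => /prod_XsubC_perm[s ls].
by exists X, s; split=> //; apply/locally_psd1P.
Qed.
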